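(* Let $q=\|\cdot\|$ be the Euclidean ($\ell_2$) norm on $\mathbb{R}^{n_1}$, and consider the $\ell_2$ norm based metric nearness problem $\min_{y\in\mathbb{R}^{n_1}}\{h(Ay-b)+q(Dy)\}$. Suppose that $y=0$ is not an optimal solution of this problem. Let $(\bar y,\bar u,\bar v)\in\mathbb{R}^{n_1}\times\mathbb{R}^{n_2}\times\mathbb{R}^{n_1}$ be a solution of the KKT system $$A^{T}u+D^{T}v=0,\quad Ay-b\in\partial h^{*}(u),\quad Dy\in\partial q^{*}(v).$$ Then the error bound condition for $\mathcal{T}_l$ holds at $(\bar y,\bar u,\bar v)$: there exist $\kappa>0$ and a neighborhood $\mathcal{U}$ of $(\bar y,\bar u,\bar v)$ such that for all $(y,u,v)\in\mathcal{U}$ $$\mathrm{dist}\big((y,u,v),\mathcal{T}_l^{-1}(0)\big)\le\kappa\,\mathrm{dist}\big(0,\mathcal{T}_l(y,u,v)\big).$$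
   Context: Setting. Let $n\ge 3$ be an integer, $n_1=n(n-1)/2$, $n_2=n(n-1)(n-2)/2$. For a real symmetric $n\times n$ matrix $X=(x_{ij})$ put $\mathrm{trivec}(X)=[x_{12},x_{13},x_{23},\ldots,x_{1n},\ldots,x_{n-1,n}]^T\in\mathbb{R}^{n_1}$. $A\in\mathbb{R}^{n_2\times n_1}$ is the triangle inequality matrix: for each $1\le i<j<k\le n$ it has three rows, for which the corresponding components of $A\,\mathrm{trivec}(X)$ are $x_{ij}-x_{ik}-x_{jk}$, $x_{ik}-x_{ij}-x_{jk}$ and $x_{jk}-x_{ij}-x_{ik}$. $\widetilde X$ is a given nonnegative symmetric zero-diagonal matrix, $b=-A\,\mathrm{trivec}(\widetilde X)$, and $D=\mathrm{diag}(\mathrm{trivec}(W))$ for a given symmetric weight matrix $W$, all diagonal entries of $D$ being positive. $h=\delta_{C}$ is the indicator function of $C=\mathbb{R}^{n_2}_-$ ($0$ on $C$, $+\infty$ elsewhere). $f^*$ denotes the convex conjugate and $\partial f$ the convex subdifferential, so $h^*$ is the indicator function of $\mathbb{R}^{n_2}_+$ and $q^*$ that of the closed Euclidean unit ball. The Lagrangian is $l(y;u,v)=-h^*(u)-q^*(v)+\langle u,Ay-b\rangle+\langle v,Dy\rangle$, and the maximal monotone operator $\mathcal{T}_l$ is $\mathcal{T}_l(y,u,v)=\{(y',u',v') : (y',-u',-v')\in\partial l(y,u,v)\}$, with $\partial l$ the subdifferential of the convex-concave function $l$; explicitly, $$\mathcal{T}_l(y,u,v)=\{A^Tu+D^Tv\}\times\big(\partial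 h^*(u)-(Ay-b)\big)\times\big(\partial q^*(v)-Dy\big).$$ Thus $\mathcal{T}_l^{-1}(0)$ is the set of all solutions of the KKT system. $\mathrm{dist}$ is the Euclidean distance, with $\mathrm{dist}(x,\emptyset)=+\infty$. *)

(* Defs.v *)
From HB Require Import structures.
From mathcomp Require Import all_boot all_order all_algebra.
From mathcomp Require Import all_classical all_reals all_analysis.

Set Implicit Arguments.
Unset Strict Implicit.
Unset Printing Implicit Defensive.

Import Order.TTheory GRing.Theory Num.Theory.
Import numFieldNormedType.Exports.

Local Open Scope classical_set_scope.
Local Open Scope ring_scope.

Definition n1 (n : nat) : nat := ((n * n.-1) %/ 2)%N.
Definition n2 (n : nat) : nat := ((n * n.-1 * n.-2) %/ 2)%N.

(* The pairs i < j, listed by increasing j, then by increasing i: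
   (0,1), (0,2), (1,2), (0,3), ... *)
Definition pairs (n : nat) : seq ('I_n * 'I_n) :=
  [seq p : 'I_n * 'I_n <- [seq (i, j) | j <- enum 'I_n, i <- enum 'I_n] | (p.1 < p.2)%N].

Definition triples (n : nat) : seq ('I_n * 'I_n * 'I_n) :=
  [seq t : 'I_n * 'I_n * 'I_n <- [seq (p, k) | k <- enum 'I_n, p <- pairs n] | (t.1.2 < t.2)%N].

(* A row (p, q, r) stands for the expression x_p - x_q - x_r. *)
Definition triangle_row (n : nat) : Type :=
  (('I_n * 'I_n) * ('I_n * 'I_n) * ('I_n * 'I_n))%type.

Definition rows_of_triple (n : nat) (t : 'I_n * 'I_n * 'I_n) :
    seq (triangle_row n) :=
  let: (i, j, k) := t in
  [:: ((i, j), (i, k), (j, k));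
      ((i, k), (i, j), (j, k));
      ((j, k), (i, j), (i, k))].

Definition triangle_rows (n : nat) : seq (triangle_row n) :=
  flatten [seq rows_of_triple t | t <- triples n].

Lemma count_ltn_ord (n : nat) (j : 'I_n) :
  count (fun i : 'I_n => (i < j)%N) (enum 'I_n) = j.
Proof.
rewrite -(count_map val (fun i => (i < j)%N)) val_enum_ord.
have -> : iota 0 n = iota 0 j ++ iota j (n - j).
  by have := iotaD 0 j (n - j); rewrite subnKC // ltnW.
rewrite count_cat.
rewrite (_ : count _ (iota 0 j) = j); last first.
  transitivity (size (iota 0 j)); last by rewrite size_iota.
  by apply/eqP; rewrite -all_count; apply/allP => i; rewrite mem_iota add0n.
rewrite (_ : count _ (iota j _) = 0%N) ?addn0 //.
apply/eqP; rewrite -leqn0 leqNgt -has_count -all_predC.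
by apply/allP => i; rewrite mem_iota /= -leqNgt => /andP[].
Qed.

Lemma count_pairs_lt (n : nat) (k : nat) : (k <= n)%N ->
  count (fun p : 'I_n * 'I_n => (p.2 < k)%N) (pairs n) = 'C(k, 2).
Proof.
move=> kn; rewrite /pairs count_filter count_flatten -map_comp sumnE big_map.
under eq_bigr => j _ do rewrite /= count_map.
rewrite big_enum /=.
transitivity (\sum_(j < n | (j < k)%N) j)%N.
  rewrite [RHS]big_mkcond; apply: eq_bigr => j _.
  case: ifP => jk.
    rewrite -[RHS]count_ltn_ord; apply: eq_count => i /=.
    by rewrite jk.
  by rewrite -[RHS](count_pred0 (enum 'I_n)); apply: eq_count => i /=; rewrite jk.
by rewrite (big_ord_narrow kn) /= -bin2_sum big_mkord.
Qed.

Lemma size_pairs (n : nat) : size (pairs n) = n1 n.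
Proof.
rewrite /n1 divn2 -bin2 -(count_pairs_lt (leqnn n)) -[LHS]count_predT.
by apply: eq_count => -[i j] /=; rewrite ltn_ord.
Qed.

Lemma size_triples (n : nat) : size (triples n) = 'C(n, 3).
Proof.
rewrite /triples size_filter count_flatten -map_comp sumnE big_map big_enum /=.
under eq_bigr => k _ do
  rewrite /= count_map (count_pairs_lt (ltnW (ltn_ord k))).
elim: n => [|n IHn]; first by rewrite big_ord0.
by rewrite big_ord_recr /= IHn binS.
Qed.

Lemma size_triangle_rows (n : nat) : size (triangle_rows n) = n2 n.
Proof.
have -> : size (triangle_rows n) = (3 * size (triples n))%N.
  rewrite /triangle_rows; elim: (triples n) => //= -[[i j] k] s IHs.
  by rewrite /= IHs mulnS.
rewrite size_triples /n2.
have -> : (n * n.-1 * n.-2 = 'C(n, 3) * 3 * 2)%N.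
  by rewrite -[RHS]mulnA [RHS](bin_ffact n 3) !ffactnS ffactn0 muln1 mulnA.
by rewrite mulnK // mulnC.
Qed.

Definition pair_tuple (n : nat) : (n1 n).-tuple ('I_n * 'I_n) :=
  Tuple (introT eqP (size_pairs n)).

Definition triangle_row_tuple (n : nat) : (n2 n).-tuple (triangle_row n) :=
  Tuple (introT eqP (size_triangle_rows n)).

Definition trivec (R : realType) (n : nat) (X : 'M[R]_n) : 'cV[R]_(n1 n) :=
  \col_c let: (i, j) := tnth (pair_tuple n) c in X i j.

Definition triangle_mx (R : realType) (n : nat) : 'M[R]_(n2 n, n1 n) :=
  \matrix_(r, c)
    let: (p, q, s) := tnth (triangle_row_tuple n) r in
    let e := tnth (pair_tuple n) c in
    (e == p)%:R - (e == q)%:R - (e == s)%:R.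

Section Euclidean.
Context {R : realType}.

Definition dot (m : nat) (x y : 'cV[R]_m) : R := \sum_i x i 0 * y i 0.

(* The library's `|x| on matrices is the max norm. *)
Definition enorm (m : nat) (x : 'cV[R]_m) : R := Num.sqrt (dot x x).

Definition enorm3 (m k p : nat) (z : 'cV[R]_m * 'cV[R]_k * 'cV[R]_p) : R :=
  Num.sqrt (enorm z.1.1 ^+ 2 + enorm z.1.2 ^+ 2 + enorm z.2 ^+ 2).

(* The infimum in \bar R of the empty set is +oo. *)
Definition dist (m k p : nat) (z : 'cV[R]_m * 'cV[R]_k * 'cV[R]_p)
    (S : set ('cV[R]_m * 'cV[R]_k * 'cV[R]_p)) : \bar R :=
  ereal_inf [set (enorm3 (z - w))%:E | w in S].

End Euclidean.

Section ConvexAnalysis.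
Context {R : realType}.
Local Open Scope ereal_scope.

Definition indicator (m : nat) (C : set 'cV[R]_m) (x : 'cV[R]_m) : \bar R :=
  if x \in C then 0 else +oo.

Definition conjugate (m : nat) (f : 'cV[R]_m -> \bar R) (u : 'cV[R]_m) :
    \bar R :=
  ereal_sup [set (dot u x)%:E - f x | x in [set: 'cV[R]_m]].

Definition subdiff (m : nat) (f : 'cV[R]_m -> \bar R) (x : 'cV[R]_m) :
    set 'cV[R]_m :=
  [set g | forall z, f x + (dot g (z - x)%R)%:E <= f z].

(* The subdifferential of a function l(y; u, v) that is convex in y and
   concave in (u, v): (y', u', v') is in it at (y, u, v) when y' is a
   subgradient of l(.; u, v) at y and (u', v') is a supergradient of l(y; ., .)
   at (u, v). *)
Definition saddle_subdiff (m k p : nat)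
    (l : 'cV[R]_m -> 'cV[R]_k -> 'cV[R]_p -> \bar R)
    (z : 'cV[R]_m * 'cV[R]_k * 'cV[R]_p) :
    set ('cV[R]_m * 'cV[R]_k * 'cV[R]_p) :=
  [set g | let: (y, u, v) := z in let: (y', u', v') := g in
    subdiff (fun x => l x u v) y y' /\
    forall s t,
      l y s t <= l y u v + (dot u' (s - u)%R + dot v' (t - v)%R)%R%:E].

Definition lagrangian (m k p : nat)
    (h : 'cV[R]_k -> \bar R) (q : 'cV[R]_p -> \bar R)
    (A : 'M[R]_(k, m)) (b : 'cV[R]_k) (D : 'M[R]_(p, m))
    (y : 'cV[R]_m) (u : 'cV[R]_k) (v : 'cV[R]_p) : \bar R :=
  - conjugate h u - conjugate q v
  + (dot u (A *m y - b)%R)%:E + (dot v (D *m y)%R)%:E.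

Definition lagrangian_op (m k p : nat)
    (h : 'cV[R]_k -> \bar R) (q : 'cV[R]_p -> \bar R)
    (A : 'M[R]_(k, m)) (b : 'cV[R]_k) (D : 'M[R]_(p, m))
    (z : 'cV[R]_m * 'cV[R]_k * 'cV[R]_p) :
    set ('cV[R]_m * 'cV[R]_k * 'cV[R]_p) :=
  [set w | let: (y', u', v') := w in
    saddle_subdiff (lagrangian h q A b D) z (y', (- u')%R, (- v')%R)].

Definition is_KKT (m k p : nat)
    (h : 'cV[R]_k -> \bar R) (q : 'cV[R]_p -> \bar R)
    (A : 'M[R]_(k, m)) (b : 'cV[R]_k) (D : 'M[R]_(p, m))
    (y : 'cV[R]_m) (u : 'cV[R]_k) (v : 'cV[R]_p) : Prop :=
  [/\ (A^T *m u + D^T *m v)%R = 0%R,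
      subdiff (conjugate h) u (A *m y - b)%R &
      subdiff (conjugate q) v (D *m y)%R].

Definition is_minimizer (m : nat) (f : 'cV[R]_m -> \bar R) (x : 'cV[R]_m) :
    Prop :=
  forall z, f x <= f z.

Definition error_bound (m k p : nat)
    (T : 'cV[R]_m * 'cV[R]_k * 'cV[R]_p ->
         set ('cV[R]_m * 'cV[R]_k * 'cV[R]_p))
    (z0 : 'cV[R]_m * 'cV[R]_k * 'cV[R]_p) : Prop :=
  exists2 kappa : R, (0 < kappa)%R &
    \forall z \near z0, dist z [set w | T w 0%R] <= kappa%:E * dist 0%R (T z).

End ConvexAnalysis.

(* Main.v *)
(**
Optimality forces [v = D y / ||D y||] with [D y <> 0], so near the reference
point every [z = (y, u, v)] with a small residual has [v] on the unit sphere and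
[D y + v' = l *: v] with [l] bounded away from 0.  The sphere is curved: the
KKT operator is monotone with an extra term of order [||v - v0||^2], whence
[||v - v0||^2 <= c * ||residual|| * ||z - zhat||] for each solution
[zhat = (y0, uhat, v0)].  It remains to show
[||z - zhat|| = O(||v - v0|| + ||residual||)] for some [uhat].  For [u] this is
Hoffman's bound for the polyhedron of multipliers; for [y], which is determined
by [l] and [v], it follows from [l = - <b, u> + O(||residual||)], a perturbation
of the duality identity [||D y0|| = - <b, uhat>].
*)
Require Import Defs.
From mathcomp Require Import all_boot all_order all_algebra.
From mathcomp Require Import all_classical all_reals all_analysis.
From mathcomp Require Import ring lra.
Import Order.TTheory GRing.Theory Num.Theory.
Import numFieldNormedType.Exports.
Local Open Scope classical_set_scope.
Local Open Scope ring_scope.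

(** * Euclidean inner product and norm on column vectors *)

Section EuclideanTheory.
Set Implicit Arguments.
Unset Strict Implicit.
Context {R : realType}.

Lemma dotC (m : nat) (x y : 'cV[R]_m) : dot x y = dot y x.
Proof. by apply: eq_bigr => i _; rewrite mulrC. Qed.

Lemma dotDl (m : nat) (x y z : 'cV[R]_m) : dot (x + y) z = dot x z + dot y z.
Proof. by rewrite -big_split; apply: eq_bigr => i _; rewrite !mxE mulrDl. Qed.

Lemma dotZl (m : nat) a (x z : 'cV[R]_m) : dot (a *: x) z = a * dot x z.
Proof. by rewrite mulr_sumr; apply: eq_bigr => i _; rewrite !mxE mulrA. Qed.

Lemma dotNl (m : nat) (x z : 'cV[R]_m) : dot (- x) z = - dot x z.
Proof. by rewrite -scaleN1r dotZl mulN1r. Qed.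

Lemma dotBl (m : nat) (x y z : 'cV[R]_m) : dot (x - y) z = dot x z - dot y z.
Proof. by rewrite dotDl dotNl. Qed.

Lemma dotDr (m : nat) (x y z : 'cV[R]_m) : dot z (x + y) = dot z x + dot z y.
Proof. by rewrite !(dotC z) dotDl. Qed.

Lemma dotZr (m : nat) a (x z : 'cV[R]_m) : dot z (a *: x) = a * dot z x.
Proof. by rewrite !(dotC z) dotZl. Qed.

Lemma dotNr (m : nat) (x z : 'cV[R]_m) : dot z (- x) = - dot z x.
Proof. by rewrite !(dotC z) dotNl. Qed.

Lemma dotBr (m : nat) (x y z : 'cV[R]_m) : dot z (x - y) = dot z x - dot z y.
Proof. by rewrite dotDr dotNr. Qed.

Lemma dot0r (m : nat) (z : 'cV[R]_m) : dot z 0 = 0.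
Proof. by rewrite -(scale0r 0) dotZr mul0r. Qed.

Lemma dot0l (m : nat) (z : 'cV[R]_m) : dot 0 z = 0.
Proof. by rewrite dotC dot0r. Qed.

Lemma dot_deltar (m : nat) (z : 'cV[R]_m) i : dot z (delta_mx i 0) = z i 0.
Proof.
rewrite /dot (bigD1 i) //= big1 ?mxE ?eqxx ?mulr1 ?addr0 // => j /negPf ji.
by rewrite mxE ji mulr0.
Qed.

Lemma dot_trmx (m k : nat) (A : 'M[R]_(k, m)) u y :
  dot (A^T *m u) y = dot u (A *m y).
Proof.
have dotE p (x z : 'cV[R]_p) : dot x z = (x^T *m z) 0 0.
  by rewrite mxE; apply: eq_bigr => i _; rewrite mxE.
by rewrite !dotE trmx_mul trmxK mulmxA.
Qed.

Lemma dot_ge0 (m : nat) (x : 'cV[R]_m) : 0 <= dot x x.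
Proof. by apply: sumr_ge0 => i _; rewrite -expr2 sqr_ge0. Qed.

Lemma dot_eq0 (m : nat) (x : 'cV[R]_m) : dot x x = 0 -> x = 0.
Proof.
move/eqP; rewrite psumr_eq0 => [/allP h|i _]; last by rewrite -expr2 sqr_ge0.
apply/matrixP => i j; rewrite ord1 mxE; apply/eqP.
by have := h i (mem_index_enum i); rewrite mulf_eq0 orbb.
Qed.

Lemma enorm_ge0 (m : nat) (x : 'cV[R]_m) : 0 <= enorm x.
Proof. exact: sqrtr_ge0. Qed.

Lemma enorm_sqr (m : nat) (x : 'cV[R]_m) : enorm x ^+ 2 = dot x x.
Proof. by rewrite sqr_sqrtr // dot_ge0. Qed.

Lemma enorm_eq0 (m : nat) (x : 'cV[R]_m) : enorm x = 0 -> x = 0.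
Proof. by move=> x0; apply: dot_eq0; rewrite -enorm_sqr x0 expr0n. Qed.

Lemma enorm0 (m : nat) : enorm (0 : 'cV[R]_m) = 0.
Proof. by rewrite /enorm dot0l sqrtr0. Qed.

Lemma enorm_gt0 (m : nat) (x : 'cV[R]_m) : x <> 0 -> 0 < enorm x.
Proof. by move=> x0; rewrite lt0r enorm_ge0 andbT; apply/eqP => /enorm_eq0. Qed.

Lemma enormZ (m : nat) a (x : 'cV[R]_m) : enorm (a *: x) = `|a| * enorm x.
Proof.
by rewrite /enorm dotZl dotZr mulrA -expr2 sqrtrM ?sqr_ge0 // sqrtr_sqr.
Qed.

Lemma enormN (m : nat) (x : 'cV[R]_m) : enorm (- x) = enorm x.
Proof. by rewrite -scaleN1r enormZ normrN1 mul1r. Qed.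

Lemma dot_le (m : nat) (x y : 'cV[R]_m) : dot x y <= enorm x * enorm y.
Proof.
have [x0|/eqP/enorm_gt0 x0] := eqVneq x 0; first by rewrite x0 dot0l enorm0 mul0r.
have [y0|/eqP/enorm_gt0 y0] := eqVneq y 0; first by rewrite y0 dot0r enorm0 mulr0.
(* Expanding this square gives twice the desired inequality multiplied by the positive factor
   [enorm x * enorm y]. *)
have := dot_ge0 (enorm y *: x - enorm x *: y).
rewrite dotBl !dotBr !dotZl !dotZr -!enorm_sqr (dotC y x) => h.
have xy0 := mulr_gt0 x0 y0.
by rewrite -(ler_pM2l xy0); nra.
Qed.

Lemma norm_dot_le (m : nat) (x y : 'cV[R]_m) : `|dot x y| <= enorm x * enorm y.
Proof.
rewrite ler_norml dot_le andbT lerNl -dotNl (le_trans (dot_le _ _)) //.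
by rewrite enormN.
Qed.

Lemma enormD (m : nat) (x y : 'cV[R]_m) : enorm (x + y) <= enorm x + enorm y.
Proof.
rewrite -ler_sqr ?nnegrE ?addr_ge0 ?enorm_ge0 //.
rewrite enorm_sqr dotDl !dotDr (dotC y x) -!enorm_sqr.
by have := dot_le x y; nra.
Qed.

Lemma coord_le_enorm (m : nat) (x : 'cV[R]_m) i : `|x i 0| <= enorm x.
Proof.
rewrite -ler_sqr ?nnegrE ?enorm_ge0 // enorm_sqr real_normK ?num_real //.
rewrite /dot (bigD1 i) //= -expr2 lerDl.
by apply: sumr_ge0 => j _; rewrite -expr2 sqr_ge0.
Qed.

Lemma mulmx_enorm_bound (m k : nat) (A : 'M[R]_(k, m)) :
  exists2 L, 0 <= L & forall x, enorm (A *m x) <= L * enorm x.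
Proof.
(* [L] is the Frobenius norm; the bound is Cauchy-Schwarz applied row by row. *)
pose L := Num.sqrt (\sum_i dot (row i A)^T (row i A)^T).
exists L => [|x]; first exact: sqrtr_ge0.
rewrite -ler_sqr ?nnegrE ?mulr_ge0 ?enorm_ge0 ?sqrtr_ge0 //.
rewrite enorm_sqr exprMn sqr_sqrtr; last first.
  by apply: sumr_ge0 => i _; exact: dot_ge0.
rewrite mulr_suml; apply: ler_sum => i _.
have -> : (A *m x) i 0 = dot (row i A)^T x.
  by rewrite mxE; apply: eq_bigr => j _; rewrite !mxE.
rewrite -expr2 -!enorm_sqr -exprMn -real_normK ?num_real //.
by rewrite ler_sqr ?nnegrE ?mulr_ge0 ?enorm_ge0 // norm_dot_le.
Qed.

Lemma continuous_sum (T : topologicalType) (I : finType) (f : I -> T -> R) :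
  (forall i, continuous (f i)) -> continuous (fun t => \sum_i f i t).
Proof.
move=> cf; apply: continuous_big => [|i _]; last exact: cf.
exact: (@add_continuous R^o).
Qed.

Lemma continuous_enorm (T : topologicalType) (m : nat) (f : T -> 'cV[R]_m) :
  (forall i, continuous (fun t => f t i 0)) -> continuous (fun t => enorm (f t)).
Proof.
move=> cf t.
apply: (@continuous_comp _ _ _ (fun t => dot (f t) (f t)) Num.sqrt).
  by apply: continuous_sum => i {}t; apply: cvgM; exact: cf.
exact: sqrt_continuous.
Qed.

End EuclideanTheory.

(** * Hoffman's error bound for linear systems with sign constraints *)

Section Hoffman.
Set Implicit Arguments.
Unset Strict Implicit.
Context {R : realType}.

(** [P] and [N] list the coordinates that may be positive and negative respectively; a coordinate in
    neither set must vanish. *)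
Definition sign_cone (m : nat) (P N : {set 'I_m}) (e : 'cV[R]_m) : Prop :=
  forall i, (i \notin P -> e i 0 <= 0) /\ (i \notin N -> 0 <= e i 0).

(** The unit vectors of the cone form a compact set on which [enorm (M *m e)] attains a minimum,
    positive by injectivity. Its inverse serves as [H], by homogeneity. *)
Lemma sign_cone_bound (m k : nat) (M : 'M[R]_(k, m)) (P N : {set 'I_m}) :
  (forall e, sign_cone P N e -> M *m e = 0 -> e = 0) ->
  exists2 H, 0 <= H &
    forall e, sign_cone P N e -> enorm e <= H * enorm (M *m e).
Proof.
move=> inj.
(* Row vectors, to match the compactness and extreme value theorems applied below. *)
pose S : set 'rV[R]_m := [set e | sign_cone P N e^T /\ enorm e^T = 1].
have coneZ a e : 0 <= a -> sign_cone P N e -> sign_cone P N (a *: e).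
  move=> a0 Pe i; have [h1 h2] := Pe i; rewrite !mxE; split=> h.
    by rewrite mulr_ge0_le0 // h1.
  by rewrite mulr_ge0 // h2.
have normS e : sign_cone P N e -> e <> 0 -> S ((enorm e)^-1 *: e)^T.
  move=> Pe /enorm_gt0 e0; rewrite /S /= trmxK; split.
    by apply: coneZ; rewrite // invr_ge0 ltW.
  by rewrite enormZ ger0_norm ?invr_ge0 ?(ltW e0) // mulVf // gt_eqF.
have [S0|S0] := pselect (S !=set0); last first.
  (* Without unit vectors the cone is reduced to 0. *)
  exists 0 => // e Pe; rewrite mul0r.
  have [->|/eqP e0] := eqVneq e 0; first by rewrite enorm0.
  by case: S0; exists ((enorm e)^-1 *: e)^T; exact: normS.
have coordT j : continuous (fun t : 'rV[R]_m => t^T j 0).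
  move=> t; under eq_fun do rewrite mxE; exact: coord_continuous.
have cS : compact S.
  apply: bounded_closed_compact.
    exists 1; split => // x x1 e [_ e1].
    apply: (le_trans _ (ltW x1)); rewrite [leLHS]mx_normrE.
    apply: bigmax_le => // -[i j] _ /=.
    by rewrite -e1 (ord1 i); have := coord_le_enorm e^T j; rewrite mxE.
  have -> : S = (\bigcap_(i in [set: 'I_m])
      ([set e | i \notin P -> e^T i 0 <= 0] `&`
       [set e | i \notin N -> 0 <= e^T i 0])) `&` [set e | enorm e^T = 1].
    by apply/seteqP; split=> e [h1 h2]; split=> // i; have := h1 i; exact.
  apply: closedI; last first.
    apply: (@preimage_closed _ _ (fun e : 'rV_m => enorm e^T) [set 1]).
      by move=> x _; exact: continuous_enorm.
    exact: closed_eq.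
  apply: closed_bigI => i _; apply: closedI.
    have [iP|iP] := boolP (i \in P).
      by rewrite (_ : mkset _ = setT); [exact: closedT | apply/seteqP; split].
    rewrite (_ : mkset _ = (fun t : 'rV[R]_m => t^T i 0) @^-1` [set x | x <= 0]).
      by apply: preimage_closed => [x _|]; [exact: coordT|exact: closed_le].
    by apply/seteqP; split=> // e /=; exact.
  have [iN|iN] := boolP (i \in N).
    by rewrite (_ : mkset _ = setT); [exact: closedT | apply/seteqP; split].
  rewrite (_ : mkset _ = (fun t : 'rV[R]_m => t^T i 0) @^-1` [set x | x >= 0]).
    by apply: preimage_closed => [x _|]; [exact: coordT|exact: closed_ge].
  by apply/seteqP; split=> // e /=; exact.
have [|c /set_mem[Pc c1] cmin] :=
    @EVT_min_rV R m (fun e => enorm (M *m e^T)) S S0 cS.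
  apply: continuous_subspaceT; apply: continuous_enorm => i.
  under eq_fun do rewrite mxE.
  apply: continuous_sum => j t.
  by apply: (@continuousM _ _ (fun=> M i j)); [exact: cst_continuous|exact: coordT].
have mu0 : 0 < enorm (M *m c^T).
  apply: enorm_gt0 => /(inj _ Pc) c0; move: c1; rewrite c0 enorm0 => /eqP.
  by rewrite eq_sym oner_eq0.
exists (enorm (M *m c^T))^-1; first by rewrite invr_ge0 ltW.
move=> e Pe; have [->|/eqP e0] := eqVneq e 0.
  by rewrite enorm0 mulr_ge0 ?enorm_ge0 // invr_ge0 ltW.
rewrite ler_pdivlMl // -ler_pdivlMr ?enorm_gt0 //.
have := cmin _ (mem_set (normS _ Pe e0)).
rewrite /= trmxK -scalemxAr enormZ ger0_norm ?invr_ge0 ?enorm_ge0 //.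
by rewrite mulrC.
Qed.

(** Where [d] vanishes both implications apply, so [e] vanishes too: the support of [e] lies in that
    of [d]. *)
Definition conformal (m : nat) (d e : 'cV[R]_m) : Prop :=
  forall i, (d i 0 <= 0 -> e i 0 <= 0) /\ (0 <= d i 0 -> 0 <= e i 0).

(* The bound is uniform in d since only finitely many sign patterns occur. *)
Lemma conformal_bound (m k : nat) (M : 'M[R]_(k, m)) :
  exists2 H, 0 <= H &
    forall d, (forall e, conformal d e -> M *m e = 0 -> e = 0) ->
      enorm d <= H * enorm (M *m d).
Proof.
have HPN (s : {set 'I_m} * {set 'I_m}) : exists H : R, 0 <= H /\
    ((forall e, sign_cone s.1 s.2 e -> M *m e = 0 -> e = 0) ->
     forall e, sign_cone s.1 s.2 e -> enorm e <= H * enorm (M *m e)).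
  have [/sign_cone_bound[H H0 HP]|n] := pselect
    (forall e, sign_cone s.1 s.2 e -> M *m e = 0 -> e = 0).
  - by exists H.
  - by exists 0.
have [H HP] := choice HPN.
(* The sum over all sign patterns dominates each of its nonnegative terms; patterns without
   injectivity contribute a harmless constant. *)
exists (\sum_s H s) => [|d inj].
  by apply: sumr_ge0 => s _; have [] := HP s.
pose s := ([set i | 0 < d i 0]%SET, [set i | d i 0 < 0]%SET).
have sE e : sign_cone s.1 s.2 e = conformal d e.
  by apply/propext; split=> h i; have := h i; rewrite !inE -!leNgt.
have [_ Hs] := HP s.
have /le_trans : enorm d <= H s * enorm (M *m d).
  by apply: Hs => [e|]; rewrite sE //; exact: inj.
apply; rewrite ler_wpM2r ?enorm_ge0 // (bigD1 s) //= lerDl.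
by apply: sumr_ge0 => t _; have [] := HP t.
Qed.

(* As long as some nonzero e in the kernel is conformal to d, subtracting the
   largest admissible multiple of e from d shrinks the support of d. *)
Lemma conformal_reduction (m k : nat) (M : 'M[R]_(k, m)) (d : 'cV[R]_m) :
  exists d', [/\ M *m d' = M *m d, conformal d d', conformal d (d - d') &
    forall e, conformal d' e -> M *m e = 0 -> e = 0].
Proof.
have [r] := ubnP #|[set i | d i 0 != 0]%SET|; elim: r => // r IH in d *.
rewrite ltnS => dr.
have [inj|] := pselect (forall e, conformal d e -> M *m e = 0 -> e = 0).
  by exists d; split=> // i; rewrite ?subrr ?mxE.
move=> /existsNP[e] /not_implyP[de] /not_implyP[Me] /eqP e0.
have [i0 ei0] : exists i, e i 0 != 0.
  apply/existsP; apply: contra_neqT e0 => /existsPn h.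
  by apply/matrixP => i j; rewrite ord1 mxE; apply/eqP; have := h i; rewrite negbK.
(* Conformality makes these ratios nonnegative on the support of [e]; the smallest one is the
   longest step along [e] that reverses no sign, and it cancels coordinate [i]. *)
pose t i := d i 0 / e i 0.
have [i ei mint] := @arg_minP _ _ _ i0 (fun i => e i 0 != 0) t ei0.
have ratio j : e j 0 != 0 -> d j 0 = t j * e j 0 /\ 0 <= t j.
  move=> ej; split; first by rewrite /t divfK.
  have [d1 d2] := de j; rewrite /t.
  have [dj|dj] := leP 0 (d j 0); first by rewrite divr_ge0 ?d2.
  by rewrite mulr_le0 ?invr_le0 ?d1 // ltW.
have [_ ti0] := ratio i ei.
pose d1 := d - t i *: e.
have dd1 : conformal d d1.
  move=> j; rewrite /d1 !mxE.
  have [->|ej] := eqVneq (e j 0) 0; first by rewrite mulr0 subr0.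
  have [-> tj0] := ratio j ej.
  have tij := mint j ej.
  have tj : t j = 0 \/ 0 < t j by move: tj0; rewrite le_eqVlt => /orP[/eqP|]; auto.
  case: tj => tj.
    have -> : t i = 0 by apply/eqP; rewrite eq_le ti0 andbT -tj.
    by rewrite tj !mul0r subrr.
  rewrite -mulrBl; split=> h.
    by rewrite pmulr_rle0 // in h; rewrite mulr_ge0_le0 // subr_ge0.
  by rewrite pmulr_rge0 // in h; rewrite mulr_ge0 // subr_ge0.
have [|d' [Md' d1d' d1dd' inj]] := IH d1.
  apply: leq_trans dr; apply: proper_card; apply/properP; split.
    apply/fintype.subsetP => j; rewrite !inE; apply: contra_neq => dj.
    by have [a b] := dd1 j; apply/eqP; rewrite eq_le a ?b ?dj.
  exists i; rewrite !inE; last by rewrite /d1 !mxE /t divfK // subrr negbK.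
  apply/eqP => di; have [a b] := de i; move/eqP: ei; apply.
  by apply/eqP; rewrite eq_le a ?b ?di.
exists d'; split=> //.
- by rewrite Md' /d1 mulmxBr -scalemxAr Me scaler0 subr0.
- by move=> j; have [a b] := dd1 j; have [a' b'] := d1d' j; split=> h; auto.
move=> j; have [a b] := dd1 j; have [a' b'] := d1dd' j; have [a'' b''] := de j.
have -> : d - d' = (d1 - d') + t i *: e by rewrite /d1 addrAC subrK.
rewrite [((d1 - d') + _) j 0]mxE [(t i *: e) j 0]mxE; split=> h.
  by rewrite -[leRHS]addr0 lerD ?a' ?a // mulr_ge0_le0 // a''.
by rewrite addr_ge0 ?b' ?b // mulr_ge0 // b''.
Qed.

(** Split [u - u0] into a reduced vector [d] and a kernel vector, both conformal to [u - u0].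
    Conformality keeps [u - d] in the coordinate box spanned by [u] and [u0], and the uniform bound
    for reduced vectors estimates [d]. *)
Lemma hoffman_bound (m k : nat) (M : 'M[R]_(k, m)) :
  exists2 H, 0 <= H & forall u u0, exists u1,
    [/\ M *m u1 = M *m u0, enorm (u - u1) <= H * enorm (M *m (u - u0)) &
     forall i, Num.min (u i 0) (u0 i 0) <= u1 i 0 <= Num.max (u i 0) (u0 i 0)].
Proof.
have [H H0 HP] := conformal_bound M; exists H => // u u0.
have [d [Md dd dr inj]] := conformal_reduction M (u - u0).
exists (u - d); split.
- by rewrite mulmxBr Md mulmxBr opprB addrC subrK.
- by rewrite opprB addrC subrK -Md; exact: HP.
move=> i; have [a b] := dd i; have [a' b'] := dr i.
move: a b a' b'; rewrite !mxE => a b a' b'; rewrite ge_min le_max.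
have [h|/ltW h] := leP (u i 0) (u0 i 0).
  have h' : u i 0 - u0 i 0 <= 0 by rewrite subr_le0.
  have := a h'; have := a' h' => *; apply/andP; split; apply/orP.
    by left; lra.
  by right; lra.
have h' : 0 <= u i 0 - u0 i 0 by rewrite subr_ge0.
have := b h'; have := b' h' => *; apply/andP; split; apply/orP.
  by right; lra.
by left; lra.
Qed.

End Hoffman.

(** * Conjugates of [h] and [q], and normal cones of their domains *)

Section Conjugates.
Set Implicit Arguments.
Unset Strict Implicit.
Context {R : realType}.

Let h (m : nat) : 'cV[R]_m -> \bar R :=
  indicator [set x : 'cV[R]_m | forall i, x i 0 <= 0].
Let q (m : nat) : 'cV[R]_m -> \bar R := fun x => (enorm x)%:E.

Lemma conjugate_geN (m : nat) (f : 'cV[R]_m -> \bar R) u x :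
  ((dot u x)%:E - f x <= conjugate f u)%E.
Proof. by apply: ereal_sup_ubound; exists x. Qed.

Lemma conjugate_nonpos_indicator (m : nat) (u : 'cV[R]_m) :
  conjugate (h (m:=m)) u = if `[< forall i, 0 <= u i 0 >] then 0%E else +oo%E.
Proof.
case: asboolP => [u0|/existsNP[i /negP]].
  apply/eqP; rewrite eq_le; apply/andP; split.
    apply: ge_ereal_sup => _ [x _ <-]; rewrite /h /indicator.
    case: ifPn => [/set_mem x0|_]; last by rewrite leNye.
    rewrite sube0 lee_fin; apply: sumr_le0 => i _.
    exact: mulr_ge0_le0 (u0 i) (x0 i).
  apply: le_trans (conjugate_geN _ _ 0); rewrite /h /indicator mem_set.
    by rewrite dot0r sube0.
  by move=> i; rewrite mxE.
rewrite -ltNge => ui; apply/eqyP => r r0.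
(* As [u i 0 < 0], this point is in the nonpositive orthant, and its product with [u] is exactly
   [r]. *)
apply: le_trans (conjugate_geN _ _ ((r / u i 0) *: delta_mx i 0)).
rewrite /h /indicator mem_set => [|j].
  by rewrite sube0 lee_fin dotZr dot_deltar divfK // lt_eqF.
rewrite !mxE mulr_le0_ge0 ?ler0n // mulr_ge0_le0 ?(ltW r0) //.
by rewrite invr_le0 ltW.
Qed.

Lemma conjugate_enorm (m : nat) (v : 'cV[R]_m) :
  conjugate (q (m:=m)) v = if enorm v <= 1 then 0%E else +oo%E.
Proof.
case: ifPn => [v1|].
  apply/eqP; rewrite eq_le; apply/andP; split.
    apply: ge_ereal_sup => _ [x _ <-]; rewrite /q -EFinB lee_fin subr_le0.
    by rewrite (le_trans (dot_le _ _)) // ler_piMl // enorm_ge0.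
  apply: le_trans (conjugate_geN _ _ 0).
  by rewrite dot0r /q enorm0 subee.
rewrite -ltNge => v1; apply/eqyP => r r0.
have v0 : 0 < enorm v by rewrite (lt_trans _ v1).
have d0 : 0 < enorm v * (enorm v - 1) by rewrite mulr_gt0 // subr_gt0.
(* At [t *: v] with [t >= 0] the objective is [t * (enorm v ^+ 2 - enorm v)]; this [t] makes it
   equal to [r]. *)
apply: le_trans (conjugate_geN _ _ ((r / (enorm v * (enorm v - 1))) *: v)).
rewrite /q dotZr enormZ -enorm_sqr -EFinB lee_fin.
rewrite ger0_norm ?divr_ge0 ?(ltW r0) ?(ltW d0) // -mulrBr.
have -> : enorm v ^+ 2 - enorm v = enorm v * (enorm v - 1) by ring.
by rewrite divfK // gt_eqF.
Qed.

Lemma nneg_normal_cone (m : nat) (u g : 'cV[R]_m) : (forall i, 0 <= u i 0) ->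
  (forall s : 'cV[R]_m, (forall i, 0 <= s i 0) -> dot g (s - u) <= 0) <->
  (forall i, g i 0 <= 0 /\ g i 0 * u i 0 = 0).
Proof.
move=> u0; split=> [H i|H s s0].
  (* Moving along one coordinate: [t = 1] yields the sign of [g i 0], and [t = - u i 0] yields
     complementarity. *)
  have step t : 0 <= t + u i 0 -> t * g i 0 <= 0.
    move=> tu; have := H (t *: delta_mx i 0 + u).
    rewrite addrK dotZr dot_deltar; apply=> j; rewrite !mxE eqxx andbT.
    by have [->|_] := eqVneq j i; rewrite ?mulr1 // mulr0 add0r.
  have g0 : g i 0 <= 0 by rewrite -[leLHS]mul1r step // addr_ge0.
  split=> //; apply/eqP; rewrite eq_le mulr_le0_ge0 //=.
  by rewrite -oppr_le0 -mulrN mulrC step // addNr.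
rewrite /dot; apply: sumr_le0 => i _; have [g0 gu] := H i.
by rewrite !mxE mulrBr gu subr0 mulr_le0_ge0.
Qed.

(** Testing with [p] normalized gives [enorm p <= dot p v], and then the squared norm of
    [p - enorm p *: v] is at most 0. *)
Lemma ball_normal_cone (m : nat) (v p : 'cV[R]_m) : enorm v <= 1 ->
  (forall t, enorm t <= 1 -> dot p (t - v) <= 0) -> p = enorm p *: v.
Proof.
move=> v1 H; have [->|/eqP p0] := eqVneq p 0; first by rewrite enorm0 scale0r.
have np := enorm_gt0 p0.
have pv : enorm p <= dot p v.
  rewrite -subr_le0; have := H ((enorm p)^-1 *: p); rewrite dotBr dotZr.
  rewrite -enorm_sqr expr2 mulKf ?gt_eqF //; apply.
  by rewrite enormZ ger0_norm ?invr_ge0 ?(ltW np) // mulVf ?gt_eqF.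
apply/eqP; rewrite -subr_eq0; apply/eqP/dot_eq0/eqP.
rewrite eq_le dot_ge0 andbT dotBl !dotBr !dotZl !dotZr (dotC v p) -!enorm_sqr.
have : enorm v ^+ 2 <= 1 by rewrite expr_le1 ?enorm_ge0.
by move: (enorm p) (enorm v) (dot p v) np pv => *; nra.
Qed.

(** * Explicit description of the Lagrangian operator *)

Section Saddle.
Variables (m k p : nat) (A : 'M[R]_(k, m)) (b : 'cV[R]_k) (D : 'M[R]_(p, m)).
Let l := lagrangian (h (m:=k)) (q (m:=p)) A b D.

Lemma lagrangian_fin y (u : 'cV[R]_k) v : (forall i, 0 <= u i 0) -> enorm v <= 1 ->
  l y u v = (dot u (A *m y - b) + dot v (D *m y))%:E.
Proof.
move=> u0 v1; rewrite /l /lagrangian conjugate_nonpos_indicator asboolT //.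
by rewrite conjugate_enorm v1 oppe0 !add0e -EFinD.
Qed.

Lemma lagrangian_Ny y (u : 'cV[R]_k) v : ~ ((forall i, 0 <= u i 0) /\ enorm v <= 1) ->
  l y u v = -oo%E.
Proof.
move=> n; rewrite /l /lagrangian conjugate_nonpos_indicator conjugate_enorm.
by case: asboolP => u0; case: ifPn => v1 //; case: n.
Qed.

(** Where finite, the Lagrangian is affine in [y] and a sum of a term in [u] and a term in [v], so
    its subdifferential splits into one equation and two normal cone conditions. *)
Lemma lagrangian_opP y (u : 'cV[R]_k) v y' u' v' :
  lagrangian_op (h (m:=k)) (q (m:=p)) A b D (y, u, v) (y', u', v') <->
  [/\ y' = A^T *m u + D^T *m v, forall i, 0 <= u i 0, enorm v <= 1,
      forall s : 'cV[R]_k, (forall i, 0 <= s i 0) ->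
        dot (A *m y - b + u') (s - u) <= 0 &
      forall t, enorm t <= 1 -> dot (D *m y + v') (t - v) <= 0].
Proof.
have zero_ge0 i : 0 <= (0 : 'cV[R]_k) i 0 by rewrite mxE.
have zero_le1 : enorm (0 : 'cV[R]_p) <= 1 by rewrite enorm0.
have affine z : dot u (A *m z - b) + dot v (D *m z) =
    dot u (A *m y - b) + dot v (D *m y) + dot (A^T *m u + D^T *m v) (z - y).
  by rewrite dotDl !dot_trmx !mulmxBr !dotBr; ring.
split=> [[Hy Huv]|[-> u0 v1 Hs Ht]].
  have [u0 v1] : (forall i, 0 <= u i 0) /\ enorm v <= 1.
    (* Outside the domain [l y u v] is [-oo], which cannot dominate the finite value at [(0, 0)]. *)
    apply: contrapT => n; have := Huv 0 0; rewrite -/l.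
    by rewrite (lagrangian_Ny _ n) lagrangian_fin.
  have Huv' (s : 'cV[R]_k) t : (forall i, 0 <= s i 0) -> enorm t <= 1 ->
      dot (A *m y - b + u') (s - u) + dot (D *m y + v') (t - v) <= 0.
    move=> s0 t1; have := Huv s t; rewrite -/l !lagrangian_fin //.
    rewrite -EFinD lee_fin !(dotDl, dotNl, dotDr, dotNr).
    rewrite !(dotC _ s) !(dotC _ u) !(dotC _ t) !(dotC _ v); lra.
  split=> // [|s s0|t t1]; last 2 first.
  - by have := Huv' s v s0 v1; rewrite subrr dot0r addr0.
  - by have := Huv' u t u0 t1; rewrite subrr dot0r add0r.
  apply/eqP; rewrite -subr_eq0; apply/eqP/dot_eq0/eqP.
  rewrite eq_le dot_ge0 andbT dotBl subr_le0.
  (* A step along the difference of the two candidate gradients shows that its squared norm is at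
     most 0. *)
  have := Hy (y + (y' - (A^T *m u + D^T *m v))); rewrite -/l !lagrangian_fin //.
  by rewrite -EFinD lee_fin (affine (y + _)) lerD2l addrAC subrr add0r.
split=> [z|s t]; rewrite -/l; first by rewrite !lagrangian_fin // -EFinD -affine.
rewrite (lagrangian_fin _ u0 v1) -EFinD.
have [[s0 t1]|n] := pselect ((forall i, 0 <= s i 0) /\ enorm t <= 1); last first.
  by rewrite lagrangian_Ny // leNye.
rewrite lagrangian_fin // lee_fin.
have := Hs s s0; have := Ht t t1; rewrite !(dotDl, dotNl, dotDr, dotNr).
rewrite !(dotC _ s) !(dotC _ u) !(dotC _ t) !(dotC _ v); lra.
Qed.

(** Both conjugates vanish at 0, so the subgradient inequalities tested there exclude an infinite
    value at [u] or [v]. *)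
Lemma is_KKT_lagrangian_op y u v :
  is_KKT (h (m:=k)) (q (m:=p)) A b D y u v ->
  lagrangian_op (h (m:=k)) (q (m:=p)) A b D (y, u, v) (0, 0, 0).
Proof.
case=> E Hu Hv; apply/lagrangian_opP.
have zero_ge0 i : 0 <= (0 : 'cV[R]_k) i 0 by rewrite mxE.
have u0 : forall i, 0 <= u i 0.
  have := Hu 0; rewrite !conjugate_nonpos_indicator (asboolT zero_ge0).
  by case: asboolP.
have v1 : enorm v <= 1.
  by have := Hv 0; rewrite !conjugate_enorm enorm0 ler01; case: ifP.
split=> // [s s0|t t1]; rewrite addr0 -lee_fin.
  have := Hu s; rewrite !conjugate_nonpos_indicator !asboolT //.
  by rewrite add0e.
by have := Hv t; rewrite !conjugate_enorm v1 t1 add0e.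
Qed.

End Saddle.
End Conjugates.

(** * Norm comparisons and the monotonicity estimate with curvature *)

Section ErrorBound.
Set Implicit Arguments.
Unset Strict Implicit.
Context {R : realType}.

(** If [d] exceeded the bound, then [w < d], so [w + d <= 2 * d]; dividing by [c * d] would give
    [d <= (2 * K / c) * w], a contradiction. *)
Lemma quadratic_inequality_bound (c K w d : R) :
  0 < c -> 0 <= K -> 0 <= w -> 0 <= d -> c * d ^+ 2 <= w * (K * (w + d)) ->
  d <= (1 + 2 * K / c) * w.
Proof.
move=> c0 K0 w0 d0 H; rewrite leNgt; apply/negP => dw.
have s0 : 0 <= 2 * K / c by rewrite divr_ge0 ?mulr_ge0 // ltW.
have K2 : 2 * K = c * (2 * K / c) by rewrite [RHS]mulrC divfK // gt_eqF.
move: (2 * K / c) s0 K2 dw => s s0 K2 dw.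
have wd : w < d by nra.
have Kd : w * (K * (w + d)) <= w * (2 * K * d) by apply: ler_wpM2l => //; nra.
have : c * d * (d - s * w) <= 0 by rewrite K2 in Kd; nra.
by rewrite pmulr_rle0 => [?|]; [lra | rewrite mulr_gt0 // (le_lt_trans w0)].
Qed.

Lemma near_enorm (T : topologicalType) (m : nat) (f : T -> 'cV[R]_m) (t0 : T) r :
  0 < r -> continuous f -> \forall t \near t0, enorm (f t - f t0) < r.
Proof.
move=> r0 cf.
have /(_ t0) : continuous (fun t => enorm (f t - f t0)).
  apply: continuous_enorm => i t; under eq_fun do rewrite !mxE.
  apply: (@continuousB _ R^o _ (fun t => f t i 0) (fun=> f t0 i 0)).
    exact: continuous_comp (cf t) (@coord_continuous R m 1 i 0 (f t)).
  exact: cst_continuous.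
move=> /(cvgr_lt _) /(_ r); apply.
by rewrite subrr enorm0.
Qed.

Lemma le_sum3_enorm3 (m k p : nat) (z : 'cV[R]_m * 'cV[R]_k * 'cV[R]_p) :
  enorm3 z <= enorm z.1.1 + enorm z.1.2 + enorm z.2.
Proof.
have [a b c] : [/\ 0 <= enorm z.1.1, 0 <= enorm z.1.2 & 0 <= enorm z.2].
  by rewrite !enorm_ge0.
rewrite -ler_sqr ?nnegrE ?addr_ge0 ?sqrtr_ge0 // sqr_sqrtr ?addr_ge0 ?sqr_ge0 //.
by nra.
Qed.

Lemma enorm3_ge (m k p : nat) (z : 'cV[R]_m * 'cV[R]_k * 'cV[R]_p) :
  [/\ enorm z.1.1 <= enorm3 z, enorm z.1.2 <= enorm3 z & enorm z.2 <= enorm3 z].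
Proof.
have := (sqr_ge0 (enorm z.1.1), sqr_ge0 (enorm z.1.2), sqr_ge0 (enorm z.2)).
move=> [[a b] c].
by split; rewrite -[leLHS]ger0_norm ?enorm_ge0 // -sqrtr_sqr ler_wsqrtr //; lra.
Qed.

Variables (m k p : nat) (A : 'M[R]_(k, m)) (b : 'cV[R]_k) (D : 'M[R]_(p, m)).
Let h : 'cV[R]_k -> \bar R :=
  indicator [set x : 'cV[R]_k | forall i, x i 0 <= 0].
Let q : 'cV[R]_p -> \bar R := fun x => (enorm x)%:E.
Let T := lagrangian_op h q A b D.

(* The term in v is the curvature of the sphere:
   <l v - l0 v0, v - v0> = (l + l0) / 2 * ||v - v0||^2 for unit vectors. *)
Lemma lagrangian_op_mono y (u : 'cV[R]_k) v y0 u0 v0 y' u' v' :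
  T (y, u, v) (y', u', v') -> T (y0, u0, v0) (0, 0, 0) ->
  enorm v = 1 -> enorm v0 = 1 ->
  (enorm (D *m y + v') + enorm (D *m y0)) / 2 * enorm (v - v0) ^+ 2 <=
  dot y' (y - y0) + dot u' (u - u0) + dot v' (v - v0).
Proof.
move=> /lagrangian_opP[-> un v1 /(nneg_normal_cone _ un) Hs] /(ball_normal_cone v1).
set g := A *m y - b + u' in Hs *; move=> pE.
move=> /lagrangian_opP[E0 u0n v01 /(nneg_normal_cone _ u0n) Hs0].
move=> /(ball_normal_cone v01).
rewrite !addr0 in Hs0 *; set g0 := A *m y0 - b in Hs0 * => p0E nv nv0.
move: (enorm _) (enorm (D *m y0)) pE p0E => l l0 pE p0E.
(* Complementarity: [g] and [g0] are orthogonal to their own multipliers and have nonpositive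
   products with the other one, so [dot (g - g0) (u - u0) >= 0]. *)
have gu : dot g u = 0 by apply: big1 => i _; have [] := Hs i.
have gu0 : dot g u0 <= 0.
  by apply: sumr_le0 => i _; rewrite mulr_le0_ge0 //; have [] := Hs i.
have g0u : dot g0 u <= 0.
  by apply: sumr_le0 => i _; rewrite mulr_le0_ge0 //; have [] := Hs0 i.
have g0u0 : dot g0 u0 = 0 by apply: big1 => i _; have [] := Hs0 i.
have -> : u' = g - (A *m y - b) by rewrite /g [RHS]addrC addKr.
have -> : v' = l *: v - D *m y by rewrite -pE [RHS]addrC addKr.
(* Subtracting the stationarity equation of the solution makes the bilinear terms in [A] and [D]
   cancel below. *)
have -> : dot (A^T *m u + D^T *m v) (y - y0) =
    dot (A^T *m (u - u0) + D^T *m (v - v0)) (y - y0).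
  by rewrite !mulmxBr addrACA -opprD -E0 subr0.
rewrite enorm_sqr [dot (_ *m _ + _) _]dotDl !dot_trmx !mulmxBr p0E.
have -> : A *m y - A *m y0 = (A *m y - b) - g0 by rewrite /g0 opprB addrA subrK.
move: (A *m y - b) (D *m y) => Ay Dy; clearbody g g0.
have vv : dot v v = 1 by rewrite -enorm_sqr nv expr1n.
have vv0 : dot v0 v0 = 1 by rewrite -enorm_sqr nv0 expr1n.
rewrite !(dotDl, dotNl, dotZl, dotDr, dotNr, dotZr).
rewrite !(dotC _ u) !(dotC _ u0) !(dotC _ v) in gu gu0 g0u g0u0 vv *.
rewrite !(dotC _ v0) in vv0 *; rewrite !(dotC v0 v) vv vv0 gu g0u0.
by move: (dot v v0) => ?; lra.
Qed.

End ErrorBound.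

(** * Local estimates for multipliers and primal points, and the error bound *)

Section LocalBound.
Set Implicit Arguments.
Unset Strict Implicit.
Context {R : realType}.
Variables (m k p : nat) (A : 'M[R]_(k, m)) (b : 'cV[R]_k) (D : 'M[R]_(p, m)).
Let h : 'cV[R]_k -> \bar R :=
  indicator [set x : 'cV[R]_k | forall i, x i 0 <= 0].
Let q : 'cV[R]_p -> \bar R := fun x => (enorm x)%:E.
Let T := lagrangian_op h q A b D.

Lemma negative_coord_gap (g : 'cV[R]_k) :
  exists2 e, 0 < e & forall i, g i 0 < 0 -> e <= - g i 0.
Proof.
(* The default 1 keeps the minimum positive when no coordinate is negative. *)
exists (\big[Num.min/1]_(i | g i 0 < 0) - g i 0) => [|i gi].
  by apply: lt_bigmin => // i gi; rewrite oppr_gt0.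
exact: bigmin_le_cond.
Qed.

(* A constraint inactive at y0 stays inactive nearby, so u and u0 vanish there,
   hence so does u1, which lies coordinatewise between them. *)
Lemma multiplier_bound y0 u0 v0 : T (y0, u0, v0) (0, 0, 0) ->
  exists r H, [/\ 0 < r, 0 <= H & forall y u v y' u' v',
    T (y, u, v) (y', u', v') -> enorm (y - y0) < r -> enorm u' < r ->
    exists2 u1, T (y0, u1, v0) (0, 0, 0) &
      enorm (u - u1) <= H * (enorm y' + enorm (v - v0))].
Proof.
move=> /lagrangian_opP[E0 u0n v01 /(nneg_normal_cone _ u0n) Hs0 Ht0].
rewrite !addr0 in Hs0 Ht0; set g0 := A *m y0 - b in Hs0 *.
have [LA LA0 HA] := mulmx_enorm_bound A.
have [LD LD0 HD] := mulmx_enorm_bound D^T.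
have [H H0 HH] := hoffman_bound A^T.
have [e e0 He] := negative_coord_gap g0.
have LA1 : 0 < LA + 1 by lra.
(* With this radius [A *m (y - y0) + u'] has norm below [e], the slack of the inactive constraints.
   The factor [1 + LD] bounds [A^T *m (u - u0) = y' - D^T *m (v - v0)]. *)
exists (e / (LA + 1)), (H * (1 + LD)); split.
- by rewrite divr_gt0.
- by rewrite mulr_ge0 // addr_ge0.
move=> y u v y' u' v' /lagrangian_opP[yE un v1 /(nneg_normal_cone _ un) Hs _].
rewrite !ltr_pdivlMr // => yr ur.
have [u1 [Eu1 u1d u1b]] := HH u u0.
exists u1.
  apply/lagrangian_opP; split=> //; first by rewrite Eu1.
  - move=> i; apply: le_trans (andP (u1b i)).1.
    by rewrite le_min un u0n.
  - rewrite addr0 -/g0; apply/nneg_normal_cone.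
      move=> i; apply: le_trans (andP (u1b i)).1.
      by rewrite le_min un u0n.
    move=> i; have [gi0 gu0] := Hs0 i; split=> //.
    have [gi|gi] := eqVneq (g0 i 0) 0; first by rewrite gi mul0r.
    have gi_lt : g0 i 0 < 0 by rewrite lt_neqAle gi.
    have u0i : u0 i 0 = 0.
      by move/eqP: gu0; rewrite mulf_eq0 (negPf gi) /= => /eqP.
    have [ygi ygu] := Hs i.
    have ui : u i 0 = 0.
      move/eqP: ygu; rewrite mulf_eq0 => /orP[|/eqP//]; rewrite lt_eqF //.
      have : `|(A *m (y - y0) + u') i 0| < - g0 i 0.
        apply: le_lt_trans (coord_le_enorm _ _) _.
        apply: le_lt_trans (enormD _ _) _.
        apply: lt_le_trans (He _ gi_lt).
        by have := HA (y - y0); nra.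
      rewrite ltr_norml => /andP[_]; rewrite /g0 mulmxBr !mxE; lra.
    have := u1b i; rewrite ui u0i minxx maxxx -eq_le => /eqP <-.
    by rewrite mulr0.
  - by rewrite addr0.
apply: le_trans u1d _; rewrite -mulrA ler_wpM2l //.
have -> : A^T *m (u - u0) = y' - D^T *m (v - v0).
  have Eu0 : A^T *m u0 = - (D^T *m v0) by apply/eqP; rewrite -addr_eq0 -E0.
  by rewrite yE !mulmxBr Eu0 opprK opprB -addrA [D^T *m v + _]addrC subrK.
apply: le_trans (enormD _ _) _; rewrite enormN.
have := HD (v - v0); have := enorm_ge0 (v - v0); have := enorm_ge0 y'; nra.
Qed.

(** The last formula is the perturbed duality identity: pair [D *m y + v'] with [v], replace
    [D^T *m v] by [y' - A^T *m u], and use complementarity for [u]. *)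
Lemma lagrangian_op_norm y (u : 'cV[R]_k) v y' u' v' : T (y, u, v) (y', u', v') ->
  D *m y + v' != 0 ->
  [/\ D *m y + v' = enorm (D *m y + v') *: v, enorm v = 1 &
   enorm (D *m y + v') = dot v' v + dot y y' + dot u' u - dot b u].
Proof.
move=> /lagrangian_opP[yE un v1 /(nneg_normal_cone _ un) Hs].
move=> /(ball_normal_cone v1) pE /eqP/enorm_gt0 p0.
have nv : enorm v = 1.
  apply: (mulfI (lt0r_neq0 p0)); rewrite mulr1 [RHS](congr1 (@enorm _ _) pE).
  by rewrite enormZ ger0_norm // ltW.
split=> //.
have gu : dot (A *m y - b + u') u = 0 by apply: big1 => i _; have [] := Hs i.
have <- : dot (D *m y + v') v = enorm (D *m y + v').
  by rewrite {1}pE dotZl -enorm_sqr nv expr1n mulr1.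
rewrite yE dotDr !(dotC y) !dot_trmx !(dotC _ (_ *m y)).
by rewrite !(dotDl, dotNl) in gu *; lra.
Qed.

Lemma local_error_bound (E : 'M[R]_(m, p)) y0 u0 v0 : E *m D = 1%:M ->
  D *m y0 != 0 -> T (y0, u0, v0) (0, 0, 0) ->
  exists r K, [/\ 0 < r, 0 <= K & forall y u v y' u' v',
    T (y, u, v) (y', u', v') -> enorm (y - y0) < r -> enorm (u - u0) < r ->
    enorm u' < r -> enorm v' < r ->
    exists2 u1, T (y0, u1, v0) (0, 0, 0) &
      enorm (y - y0) + enorm (u - u1) + enorm (v - v0) <=
      K * (enorm y' + enorm u' + enorm v')].
Proof.
move=> ED Dy0 T0.
have l00 : 0 < enorm (D *m y0) by apply: enorm_gt0; exact/eqP.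
set l0 := enorm (D *m y0) in l00.
have [r1 [H [r10 H0 HH]]] := multiplier_bound T0.
have [LD LD0 HD] := mulmx_enorm_bound D.
have [LE LE0 HE] := mulmx_enorm_bound E.
have LD2 : 0 < 2 * (LD + 1) by lra.
(* The three bounds serve the multiplier estimate, the boundedness of [y] and [u], and the
   inequality [l0 / 2 <= enorm (D *m y + v')]. *)
pose r := Num.min (Num.min r1 1) (l0 / (2 * (LD + 1))).
have [rr1 rle1 rl] : [/\ r <= r1, r <= 1 & r * (2 * (LD + 1)) <= l0].
  by rewrite -ler_pdivlMr // /r !ge_min !lexx !orbT.
have r0 : 0 < r by rewrite /r !lt_min r10 ltr01 divr_gt0.
clearbody r.
(* The three summands bound, in units of [w + de], the distances in [y], [u] and [v]
   respectively. *)
pose K1 := (1 + (enorm y0 + 1) + (enorm u0 + 1) + enorm b * H + l0 + 1) * LE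
  + H + 1.
have K10 : 0 <= K1.
  by rewrite /K1 !addr_ge0 // mulr_ge0 // !addr_ge0 ?mulr_ge0 ?enorm_ge0 // ltW.
exists r, (K1 * (1 + (1 + 2 * K1 / (l0 / 2)))); split=> //.
  have : 0 <= 2 * K1 / (l0 / 2) by apply: divr_ge0; lra.
  by move=> ?; apply: mulr_ge0 => //; lra.
move=> y u v y' u' v' Tz yr ur u'r v'r.
have [|u1 Tu1 ub] := HH _ _ _ _ _ _ Tz _ (lt_le_trans u'r rr1).
  exact: lt_le_trans yr rr1.
exists u1 => //.
have lhalf : l0 / 2 <= enorm (D *m y + v').
  have : l0 <= enorm (D *m y + v') + enorm (D *m (y - y0) + v').
    rewrite -(enormN (D *m (y - y0) + v')).
    apply: le_trans (enormD _ _); rewrite mulmxBr opprD opprB.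
    by rewrite addrACA subrr addr0 addrC subrK.
  have := enormD (D *m (y - y0)) v'; have := HD (y - y0).
  by have := enorm_ge0 (y - y0); nra.
have p0 : D *m y + v' != 0.
  by apply: contraTneq lhalf => ->; rewrite enorm0 -ltNge divr_gt0.
have [pE nv lE] := lagrangian_op_norm Tz p0.
have [] := lagrangian_op_norm Tu1; rewrite addr0 // -/l0 => p0E nv0.
rewrite dot0r !dot0l !add0r => l0E.
(* Monotonicity is used against the solution with multiplier [u1], whose distance to [u] is
   controlled, rather than [u0]. *)
have := lagrangian_op_mono Tz Tu1 nv nv0; rewrite -/l0.
set l := enorm (D *m y + v') in lhalf pE lE *.
set al := enorm (y - y0); set be := enorm (u - u1) in ub *.
set de := enorm (v - v0) in ub *.
set w := enorm y' + enorm u' + enorm v' => mono.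
have [y'w u'w v'w] : [/\ 0 <= enorm y', 0 <= enorm u' & 0 <= enorm v'].
  by rewrite !enorm_ge0.
have w0 : 0 <= w by rewrite /w !addr_ge0.
have [al0 be0 de0] : [/\ 0 <= al, 0 <= be & 0 <= de] by rewrite !enorm_ge0.
have be_le : be <= H * (w + de).
  by apply: le_trans ub _; rewrite ler_wpM2l // lerD2r /w -addrA lerDl addr_ge0.
have y_le : enorm y <= enorm y0 + 1.
  rewrite -[y in enorm y](subrK y0) (le_trans (enormD _ _)) // addrC lerD2l.
  exact: le_trans (ltW yr) rle1.
have u_le : enorm u <= enorm u0 + 1.
  rewrite -[u in enorm u](subrK u0) (le_trans (enormD _ _)) // addrC lerD2l.
  exact: le_trans (ltW ur) rle1.
have ll0 : `|l - l0| <=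
    (1 + (enorm y0 + 1) + (enorm u0 + 1) + enorm b * H) * (w + de).
  (* Difference of the duality identities at [(y, u, v)] and [(y0, u1, v0)]. *)
  have -> : l - l0 = dot v' v + dot y y' + dot u' u - dot b (u - u1).
    by rewrite lE l0E dotBr; ring.
  apply: le_trans (ler_normB _ _) _.
  have := norm_dot_le b (u - u1); have := ler_normD (dot v' v + dot y y') (dot u' u).
  have := ler_normD (dot v' v) (dot y y').
  have := norm_dot_le v' v; have := norm_dot_le y y'; have := norm_dot_le u' u.
  rewrite nv -/be.
  have : enorm b * be <= enorm b * (H * (w + de)) by rewrite ler_wpM2l ?enorm_ge0.
  have : enorm y * enorm y' <= (enorm y0 + 1) * (w + de).
    by rewrite ler_pM ?enorm_ge0 // /w; lra.
  have : enorm u' * enorm u <= (enorm u0 + 1) * (w + de).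
    by rewrite mulrC ler_pM ?enorm_ge0 // /w; lra.
  have : enorm v' <= w + de by rewrite /w; lra.
  lra.
have al_le : al <= LE * (`|l - l0| + l0 * de + w).
  rewrite /al -[y - y0]mul1mx -ED -mulmxA (le_trans (HE _)) // ler_wpM2l //.
  (* From [D *m y + v' = l *: v] and [D *m y0 = l0 *: v0]; the left inverse [E] then recovers
     [y - y0]. *)
  have -> : D *m (y - y0) = (l - l0) *: v + l0 *: (v - v0) - v'.
    rewrite mulmxBr p0E -(addrK v' (D *m y)) pE scalerBl scalerBr addrA subrK.
    by rewrite addrAC.
  apply: le_trans (enormD _ _) _; rewrite enormN lerD //; last by rewrite /w; lra.
  apply: le_trans (enormD _ _) _; rewrite !enormZ nv mulr1.
  by rewrite (gtr0_norm l00).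
have tot : al + be + de <= K1 * (w + de).
  have : LE * (`|l - l0| + l0 * de + w) <= LE *
      ((1 + (enorm y0 + 1) + (enorm u0 + 1) + enorm b * H + l0 + 1) * (w + de)).
    have : 0 <= l0 * w by rewrite mulr_ge0 // ltW.
    by move=> ?; rewrite ler_wpM2l //; lra.
  by rewrite /K1; lra.
(* The curvature term bounds the left side; Cauchy-Schwarz bounds the pairings by
   [w * (al + be + de)]. *)
have quad : l0 / 2 * de ^+ 2 <= w * (K1 * (w + de)).
  apply: le_trans (le_trans _ mono) _.
    by rewrite ler_wpM2r ?sqr_ge0 // ler_pM2r ?invr_gt0 // lerDr; lra.
  apply: (@le_trans _ _ (w * (al + be + de))); last by rewrite ler_wpM2l.
  have := dot_le y' (y - y0); have := dot_le u' (u - u1).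
  have := dot_le v' (v - v0); rewrite -/al -/be -/de /w.
  have := mulr_ge0 y'w (addr_ge0 be0 de0); have := mulr_ge0 u'w (addr_ge0 al0 de0).
  by have := mulr_ge0 v'w (addr_ge0 al0 be0); lra.
have l20 : 0 < l0 / 2 by rewrite divr_gt0.
have := quadratic_inequality_bound l20 K10 w0 de0 quad => de_le.
apply: le_trans tot _; rewrite -[leRHS]mulrA ler_wpM2l // mulrDl mul1r.
by rewrite lerD2l.
Qed.

Lemma injective_error_bound (E : 'M[R]_(m, p)) y0 u0 v0 : E *m D = 1%:M ->
  D *m y0 != 0 -> is_KKT h q A b D y0 u0 v0 -> error_bound T (y0, u0, v0).
Proof.
move=> ED Dy0 /is_KKT_lagrangian_op T0.
have [r [K [r0 K0 HK]]] := local_error_bound ED Dy0 T0.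
(* [3 * K] handles residuals smaller than [r], each component being at most the full norm. For
   larger ones the reference point, at distance at most [3 * r], is close enough. *)
exists (3 * K + 3); first by lra.
have c1 : continuous (fun z : 'cV[R]_m * 'cV[R]_k * 'cV[R]_p => z.1.1).
  by move=> z; apply: continuous_comp; exact: cvg_fst.
have c2 : continuous (fun z : 'cV[R]_m * 'cV[R]_k * 'cV[R]_p => z.1.2).
  by move=> z; apply: continuous_comp; [exact: cvg_fst|exact: cvg_snd].
have c3 : continuous (fun z : 'cV[R]_m * 'cV[R]_k * 'cV[R]_p => z.2).
  by move=> z; exact: cvg_snd.
have n1 := near_enorm (y0, u0, v0) r0 c1.
have n2 := near_enorm (y0, u0, v0) r0 c2.
have n3 := near_enorm (y0, u0, v0) r0 c3.
apply: filterS3 n1 n2 n3 => -[[y u] v] /= yr ur vr.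
(* With the constant moved to the left, the goal is a lower bound on an infimum, which also covers
   an empty image. *)
rewrite -lee_pdivrMl; last by lra.
apply: le_ereal_inf_tmp => _ [[[y' u'] v'] Tw <-].
rewrite lee_pdivrMl -?EFinM; last by lra.
set w := enorm3 _.
have [/= y'w u'w v'w] : [/\ enorm y' <= w, enorm u' <= w & enorm v' <= w].
  have [] := enorm3_ge ((0, 0, 0) - (y', u', v')).
  by rewrite -[enorm3 _]/w /= !sub0r !enormN.
have w0 : 0 <= w := sqrtr_ge0 _.
have distE u1 c : T (y0, u1, v0) (0, 0, 0) ->
    enorm (y - y0) + enorm (u - u1) + enorm (v - v0) <= c ->
    (dist (y, u, v) [set w | T w 0%R] <= c%:E)%E.
  move=> T1 cle; apply: ge_ereal_inf.
  exists (enorm3 ((y, u, v) - (y0, u1, v0)))%:E; first by exists (y0, u1, v0).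
  by rewrite lee_fin (le_trans (le_sum3_enorm3 _)).
have [rw|wr] := leP r w.
  by apply: distE T0 _; nra.
have [||u1 T1 le1] := HK _ _ _ _ _ _ Tw yr ur.
- exact: le_lt_trans wr.
- exact: le_lt_trans wr.
apply: distE T1 _; apply: le_trans le1 _.
by nra.
Qed.

End LocalBound.

(** * Application to the metric nearness problem *)

Theorem proposition3p4 (R : realType) (n : nat) (Xt W : 'M[R]_n)
    (hn : (3 <= n)%N)
    (Xt_sym : Xt^T = Xt)
    (Xt_ge0 : forall i j, 0 <= Xt i j)
    (Xt_diag : forall i, Xt i i = 0)
    (W_sym : W^T = W) :
  let A : 'M[R]_(n2 n, n1 n) := triangle_mx R n in
  let b : 'cV[R]_(n2 n) := - (A *m trivec Xt) in
  let D : 'M[R]_(n1 n) := diag_mx (trivec W)^T in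
  let h : 'cV[R]_(n2 n) -> \bar R :=
    indicator [set x : 'cV[R]_(n2 n) | forall i, x i 0 <= 0] in
  let q : 'cV[R]_(n1 n) -> \bar R := fun x => (enorm x)%:E in
  (forall i, 0 < D i i) ->
  ~ is_minimizer (fun y => h (A *m y - b)%R + q (D *m y)%R)%E 0 ->
  forall (ybar : 'cV[R]_(n1 n)) (ubar : 'cV[R]_(n2 n)) (vbar : 'cV[R]_(n1 n)),
  is_KKT h q A b D ybar ubar vbar ->
  error_bound (lagrangian_op h q A b D) (ybar, ubar, vbar).
Proof.
move=> A b D h q D0 nmin y0 u0 v0 KKT.
have Du : D \in unitmx.
  rewrite unitmxE det_diag unitfE gt_eqF // prodr_gt0 // => i _.
  by have := D0 i; rewrite /D mxE eqxx mulr1n.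
(* If [D *m y0 = 0] then [y0 = 0], so 0 is feasible with objective value 0, the least possible: this
   contradicts the non-optimality of 0. *)
apply: (injective_error_bound (mulVmx Du)) (KKT); apply/eqP => Dy0; apply: nmin.
have y00 : y0 = 0 by rewrite -(mulKmx Du y0) Dy0 mulmx0.
have /lagrangian_opP[_ un _ /(nneg_normal_cone _ un) Hs _] :=
  is_KKT_lagrangian_op KKT.
move=> z; rewrite /h {1}/indicator mem_set; last first.
  by move=> i; have [] := Hs i; rewrite addr0 y00.
rewrite /q mulmx0 enorm0 addr0 adde_ge0 ?lee_fin ?enorm_ge0 //.
by rewrite /indicator; case: ifP => _; rewrite ?leey.
Qed.
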